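(* Let there exist $\delta > 0$ and a continuous nondecreasing function $\omega \colon [0,+\infty) \to [0,+\infty)$ such that $\omega(t) = 0$ if and only if $t = 0$ and $$\varphi(x) \ge \omega(\operatorname{dist}(x,\Omega)) \quad \text{for all } x \in X \setminus \Omega \text{ with } \varphi(x) < \delta.$$ Then for the problem $(\mathcal{P})$: minimize $f(x)$ subject to $x \in M$, $x \in Q$, to be weakly Levitin-Polyak well-posed with respect to the infeasibility measure $\varphi$ it is sufficient that this problem is weakly Levitin-Polyak well-posed in the extended sense.
   Context: $(X,d)$ is a metric space, $M,Q \subset X$ are nonempty, $f \colon X \to \mathbb{R}\cup\{+\infty\}$. The feasible region $\Omega = M \cap Q$ is nonempty and the optimal value $f_* = \inf_{x\in\Omega} f(x)$ is finite; $\operatorname{argmin}(\mathcal{P})$ is the (possibly empty) set of globally optimal solutions of $(\mathcal{P})$. $\operatorname{dist}(x,V) = \inf_{y \in V} d(x,y)$. An infeasibility measure for the constraint $x \in M$ on $Q$ is a function $\varphi \colon X \to [0,+\infty]$ such that for any $x \in Q$ one has $\varphi(x)=0 \iff x \in M$; such a $\varphi$ is fixed. $(\mathcal{P})$ is weakly Levitin-Polyak well-posed in the extended sense if $\operatorname{argmin}(\mathcal{P}) \ne \emptyset$ and for any sequence $\{x_n\} \subset X$ such that $f(x_n) \to f_*$ and $\operatorname{dist}(x_n,\Omega) \to 0$ one has $\operatorname{dist}(x_n, \operatorname{argmin}(\mathcal{P})) \to 0$. $(\mathcal{P})$ is weakly Levitin-Polyak well-posed with respect to $\varphi$ if $\operatorname{argmin}(\mathcal{P})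 \ne \emptyset$ and for any sequence $\{x_n\} \subset X$ such that $f(x_n) \to f_*$ and $\varphi(x_n) \to 0$ one has $\operatorname{dist}(x_n, \operatorname{argmin}(\mathcal{P})) \to 0$. *)

(* Defs.v *)
From mathcomp Require Import all_boot all_order all_algebra.
From mathcomp Require Import all_classical all_reals all_analysis.

Set Implicit Arguments.
Unset Strict Implicit.
Unset Printing Implicit Defensive.

Import Order.TTheory GRing.Theory Num.Theory.
Import numFieldNormedType.Exports.

Local Open Scope classical_set_scope.
Local Open Scope ring_scope.

(* [inf] takes the value 0 on the empty set, so [dist x set0 = 0] instead of
   +oo; below [dist] is only relevant for nonempty [V]. *)
Definition dist (R : realType) (X : metricType R) (x : X) (V : set X) : R :=
  inf [set mdist x y | y in V].

Section Problem.
Context (R : realType) (X : metricType R).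
Implicit Types (M Q : set X) (f phi : X -> \bar R).

Definition feasible M Q : set X := M `&` Q.

Definition optval f M Q : \bar R := ereal_inf (f @` feasible M Q).

Definition argmin f M Q : set X :=
  [set x | feasible M Q x /\ forall y, feasible M Q y -> (f x <= f y)%E].

Definition infeasibility_measure M Q phi : Prop :=
  (forall x, (0 <= phi x)%E) /\ (forall x, Q x -> (phi x = 0%E <-> M x)).

(* Limits of [f (x_ n)] and [phi (x_ n)] are taken in the extended reals. *)
Definition weakly_LP_wellposed_extended f M Q : Prop :=
  argmin f M Q !=set0 /\
  forall x_ : nat -> X,
    f (x_ n) @[n --> \oo] --> optval f M Q ->
    dist (x_ n) (feasible M Q) @[n --> \oo] --> (0 : R) ->
    dist (x_ n) (argmin f M Q) @[n --> \oo] --> (0 : R).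

Definition weakly_LP_wellposed_wrt phi f M Q : Prop :=
  argmin f M Q !=set0 /\
  forall x_ : nat -> X,
    f (x_ n) @[n --> \oo] --> optval f M Q ->
    phi (x_ n) @[n --> \oo] --> (0%E : \bar R) ->
    dist (x_ n) (argmin f M Q) @[n --> \oo] --> (0 : R).

End Problem.

(* Main.v *)
Require Import Defs.
From mathcomp Require Import all_boot all_order all_algebra.
From mathcomp Require Import all_classical all_reals all_analysis.
Import Order.TTheory GRing.Theory Num.Theory.
Import numFieldNormedType.Exports.
Local Open Scope classical_set_scope.
Local Open Scope ring_scope.

(** Both notions of well-posedness draw the same conclusion, so it is enough that [phi (x_ n)]
    tending to 0 forces [dist (x_ n) (feasible M Q)] to tend to 0. Given [e > 0], the number
    [omega e] is positive, and eventually [phi (x_ n)] lies below both [delta] and [omega e]. At an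
    infeasible [x_ n] the error bound then gives [omega (dist ...) <= phi (x_ n) < omega e], so
    monotonicity of [omega] yields a distance below [e]. *)

Lemma dist_ge0 (R : realType) (X : metricType R) (x : X) (V : set X) :
  0 <= dist x V.
Proof.
(* Bounding an infimum below by 0 needs a nonempty set; for empty [V] the default value 0 of [inf]
   settles the claim. *)
rewrite /dist; have [->|/set0P[y Vy]] := eqVneq V set0.
  by rewrite image_set0 inf0.
by apply: lb_le_inf; [exists (mdist x y); exists y | move=> _ [z _ <-]; exact: mdist_ge0].
Qed.

Lemma dist_mem_eq0 (R : realType) (X : metricType R) (x : X) (V : set X) :
  V x -> dist x V = 0.
Proof.
move=> Vx; apply/eqP; rewrite eq_le dist_ge0 andbT -[leRHS](mdistxx x).
by apply: ge_inf; [exists 0 => _ [z _ <-]; exact: mdist_ge0 | exists x].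
Qed.

Theorem proposition6 (R : realType) (X : metricType R) (M Q : set X)
    (f phi : X -> \bar R)
    (M_neq0 : M !=set0) (Q_neq0 : Q !=set0)
    (f_gtNy : forall x, f x <> -oo%E)
    (feasible_neq0 : feasible M Q !=set0)
    (optval_fin : optval f M Q \is a fin_num)
    (phi_infeas : infeasibility_measure M Q phi)
    (delta : R) (delta_gt0 : 0 < delta)
    (omega : R -> R)
    (omega_cont : {within `[0, +oo[, continuous omega})
    (omega_nondecr : forall s t : R, 0 <= s -> s <= t -> omega s <= omega t)
    (omega_ge0 : forall t : R, 0 <= t -> 0 <= omega t)
    (omega_eq0 : forall t : R, 0 <= t -> (omega t = 0 <-> t = 0))
    (phi_bound : forall x, ~ feasible M Q x -> (phi x < delta%:E)%E ->
      ((omega (dist x (feasible M Q)))%:E <= phi x)%E) :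
  weakly_LP_wellposed_extended f M Q -> weakly_LP_wellposed_wrt phi f M Q.
Proof.
move=> [argmin_neq0 wp]; split=> // x_ fx phix; apply: wp => //.
apply/cvgrPdist_lt => e e0.
have we0 : 0 < omega e.
  rewrite lt_neqAle omega_ge0 ?ltW// andbT eq_sym; apply/eqP.
  by move=> /(omega_eq0 _ (ltW e0)) e_eq0; rewrite e_eq0 ltxx in e0.
(* Used with [c = omega e] for the final estimate and with [c = delta] to make [phi_bound]
   applicable. *)
have near_lt c : 0 < c -> \forall n \near \oo, (phi (x_ n) < c%:E)%E.
  move=> c0; apply: (phix [set y | (y < c%:E)%E]).
  by apply: open_nbhs_nbhs; split; [exact: open_ereal_lt_ereal | rewrite /= lte_fin].
near=> n; rewrite sub0r normrN ger0_norm ?dist_ge0//.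
(* The error bound covers infeasible points only; at feasible ones the distance is 0. *)
have [feas|infeas] := pselect (feasible M Q (x_ n)).
  by rewrite dist_mem_eq0.
(* By contradiction: a distance of at least [e] would give [omega e <= omega (dist ...)]. *)
rewrite ltNge; apply/negP => /(omega_nondecr _ _ (ltW e0)).
apply/negP; rewrite -ltNge -lte_fin.
apply: (@le_lt_trans _ _ (phi (x_ n))); last by near: n; exact: near_lt.
by apply: phi_bound => //; near: n; exact: near_lt.
Unshelve. all: by end_near.
Qed.
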